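(* Let $G$ be a finite group and let $K$ be a subgroup of $G$. Suppose that for every Sylow subgroup $P$ of $K$ (that is, for every prime $p$ and every Sylow $p$-subgroup $P$ of $K$) one has $G = K N_G(P)$. Then $K$ is a normal subgroup of $G$.
   Context: For a subgroup $P$ of $G$, $N_G(P)=\{g\in G : g^{-1}Pg=P\}$ denotes the normalizer of $P$ in $G$. For subgroups $K, N$ of $G$, $KN=\{kn : k\in K,\ n\in N\}$ denotes the product set. *)

(* Defs.v *)
From mathcomp Require Import all_boot all_fingroup all_solvable.

Set Implicit Arguments.
Unset Strict Implicit.
Unset Printing Implicit Defensive.

(* Main.v *)
Require Import Defs.
From mathcomp Require Import all_boot all_fingroup all_solvable.

Set Implicit Arguments.
Unset Strict Implicit.
Unset Printing Implicit Defensive.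

Local Open Scope group_scope.

(** Inverting [G = K N_G(P)], every [g] in [G] is [n k] with [n] normalizing
    [P] and [k] in [K], so [P^g = P^k] lies in [K]. Since [K] is generated by
    its Sylow subgroups, [K^g] lies in [K]. *)

Theorem mainTheorem1 (gT : finGroupType) (G K : {group gT}) (sKG : K \subset G)
    (hSyl : forall (p : nat) (P : {group gT}),
       prime p -> p.-Sylow(K) P -> G = K * 'N_G(P) :> {set gT}) :
  K <| G.
Proof.
rewrite /normal sKG /=; apply/subsetP=> g Gg; rewrite inE sub_conjg.
(* With the conjugation moved to the right, the left side is [K] itself; since [K :^ g^-1] is a
   group, it is enough that it contains each Sylow subgroup. *)
rewrite -{1}(Sylow_gen K) gen_subG; apply/bigcupsP=> P /SylowP[p p_pr sylP].
rewrite -sub_conjg.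
(* Factoring [g^-1] as [k * n] gives [g = n^-1 * k^-1], so that in [P :^ g] the normalizing factor
   acts first and is absorbed by [P]. *)
have: g^-1 \in K * 'N_G(P) by rewrite -(hSyl p P p_pr sylP) groupV.
case/mulsgP=> k n Kk /setIP[_ nPn] def_gV.
rewrite -[g]invgK def_gV invMg conjsgM (normP (groupVr nPn)).
(* What remains is [P :^ k^-1 \subset K], where [k] fixes [K] by conjugation. *)
by rewrite sub_conjgV conjGid // (pHall_sub sylP).
Qed.
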